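(* Let $\mathbb{T}$ be an atomic regular time scale, $t_0\in\mathbb{T}^*$, $y_0\in\mathbb{R}$ a given constant, $p\in\mathcal{R}\cap\mathcal{R}_{\nu}$, $\alpha\in[0,1]$, and put $s_0=\rho(t_0)$. Then the following two boundary value problems for an unknown function $y:\mathbb{T}\to\mathbb{R}$ coincide (under the change of variable $s=\rho(t)$, equivalently $t=\sigma(s)$): (I) $$y^{\diamondsuit_\alpha}(t)-p(t)y(t)=0,\quad t\in\mathbb{T}^*,\qquad y(t_0)=y_0,\quad \alpha(1-\alpha)\,y(\rho(t_0))=\alpha(1-\alpha)\,y_0;$$ (II) $$\alpha\mu(s)y^{\Delta\Delta}(s)+\bigl(1-p(\sigma(s))\mu(s)\bigr)y^{\Delta}(s)-p(\sigma(s))\,y(s)=0,\quad s\in\mathbb{T}^*,\qquad y(\sigma(s_0))=y_0,\quad \alpha(1-\alpha)\,y(s_0)=\alpha(1-\alpha)\,y_0.$$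
   Context: A time scale $\mathbb{T}$ is a nonempty closed subset of $\mathbb{R}$. $\mathbb{T}^*:=\mathbb{T}\setminus\{\min\mathbb{T},\max\mathbb{T}\}$ (only those of the two that exist are removed). Forward jump: $\sigma(t)=\inf\{s\in\mathbb{T}:s>t\}$, with $\sigma(\sup\mathbb{T})=\sup\mathbb{T}$ if $\sup\mathbb{T}<\infty$; backward jump: $\rho(t)=\sup\{s\in\mathbb{T}:s<t\}$, with $\rho(\inf\mathbb{T})=\inf\mathbb{T}$ if $\inf\mathbb{T}>-\infty$. Graininess: $\mu(t)=\sigma(t)-t$, $\nu(t)=t-\rho(t)$. A point $t$ is right-scattered if $\sigma(t)>t$, right-dense if $\sigma(t)=t$, left-scattered if $\rho(t)<t$, left-dense if $\rho(t)=t$. Derivatives: $f^{\Delta}(t)$ is the number (if it exists) such that for every $\varepsilon>0$ there is a neighborhood $U\subset\mathbb{T}$ of $t$ with $|f(\sigma(t))-f(s)-f^{\Delta}(t)(\sigma(t)-s)|\le\varepsilon|\sigma(t)-s|$ for all $s\in U$; $f^{\nabla}(t)$ is defined in the same way with $\rho$ in place of $\sigma$. $f^{\Delta\Delta}=(f^\Delta)^\Delta$. For $\alpha\in[0,1]$, $f^{\diamondsuit_\alpha}(t)$ is the number (if it exists) such that for every $\varepsilon>0$ there is a neighborhood $U\subset\mathbb{T}$ of $t$ such that for all $s\in U$, $|\alpha[f(\sigma(t))-f(s)]\eta_{ts}+(1-\alpha)[f(\rho(t))-f(s)]\mu_{ts}-f^{\diamondsuit_\alpha}(t)\mu_{ts}\eta_{ts}|\le\varepsilon|\mu_{ts}\eta_{ts}|$,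 where $\mu_{ts}=\sigma(t)-s$, $\eta_{ts}=\rho(t)-s$. If $f$ is both $\Delta$- and $\nabla$-differentiable at $t$, then $f^{\diamondsuit_\alpha}(t)=\alpha f^{\Delta}(t)+(1-\alpha)f^{\nabla}(t)$. A function is rd-continuous if it is continuous at right-dense points and has finite left-sided limits at left-dense points; ld-continuous if it is continuous at left-dense points and has finite right-sided limits at right-dense points. $\mathcal{R}$ is the set of rd-continuous $p:\mathbb{T}\to\mathbb{R}$ with $1+\mu(t)p(t)\neq0$ for all $t$; $\mathcal{R}_\nu$ is the set of ld-continuous $p:\mathbb{T}\to\mathbb{R}$ with $1-\nu(t)p(t)\neq0$ for all $t$ (for regular $\mathbb{T}$ these conditions are over all $t \in \mathbb{T}$). Solutions of the dynamic equations are sought among functions that are both rd-continuous and ld-continuous on $\mathbb{T}$. $\mathbb{T}$ is regular if $\sigma(\rho(t))=t$ and $\rho(\sigma(t))=t$ for all $t\in\mathbb{T}$. An ordered finite partition of a regular time scale $\mathbb{T}$ is a set $\{\mathbb{T}_1,\dots,\mathbb{T}_n\}$ with $\mathbb{T}=\bigcup_i\mathbb{T}_i$ such that: (i) for $1\le i<n$, $\mathbb{T}_i^*\cap\mathbb{T}_{i+1}^*=\emptyset$ and $\max\mathbb{T}_i=\min\mathbb{T}_{i+1}$, while $\min\mathbb{T}_1=\min\mathbb{T}$ and $\max\mathbb{T}_n=\max\mathbb{T}$ (when these exist); (ii) each $\mathbb{T}_i$ is a regular time scale; (iii) each $t\in\mathbb{T}_i^*$ is either two-sided scattered or two-sided dense;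 (iv) writing $s_i$ for the common point of $\mathbb{T}_i$ and $\mathbb{T}_{i+1}$ ($1\le i\le n-1$), for every $\varepsilon>0$ at least one of the sets $(s_i-\varepsilon,s_i)\cap\mathbb{T}_i^*$, $(s_i,s_i+\varepsilon)\cap\mathbb{T}_{i+1}$ (these sets being nonempty) consists of two-sided scattered points only. A regular time scale $\mathbb{T}$ is atomic if its only ordered finite partition is $\{\mathbb{T}\}$ (pieces consisting of a single point are not allowed in a partition).
   Formalization: In (II), at points with μ(s)=0 the term αμ(s)y^{ΔΔ}(s) is read as 0 and y^{ΔΔ}(s) need not exist there; otherwise the claim fails, e.g. T=ℝ, α=1, p(t)=|t|, y=exp(t|t|/2), where y''(0) does not exist. *)

(* Defs.v *)
From HB Require Import structures.
From mathcomp Require Import all_boot all_order all_algebra.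
From mathcomp Require Import all_classical all_reals all_analysis.
Set Implicit Arguments.
Unset Strict Implicit.
Unset Printing Implicit Defensive.
Import Order.TTheory GRing.Theory Num.Theory.
Import numFieldNormedType.Exports.
Local Open Scope classical_set_scope.
Local Open Scope ring_scope.

(* A function T -> R on a time scale is represented by a total function
   R -> R; every notion below only looks at its values on T. *)

Section TimeScale.
Context {R : realType}.
Implicit Types (T : set R) (f g p y : R -> R) (t s d m alpha : R).

Definition time_scale T : Prop := T !=set0 /\ closed T.

Definition is_minimum T m : Prop := T m /\ (forall t, T t -> m <= t).
Definition is_maximum T m : Prop := T m /\ (forall t, T t -> t <= m).

Definition tstar T : set R :=
  [set t | T t /\ ~ is_minimum T t /\ ~ is_maximum T t].

(* For t in T, the set of later points is empty exactly when t = max T, and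
   then the convention is sigma(t) = t; similarly for rho at min T. *)
Definition sigma T t : R :=
  if pselect ([set s | T s /\ t < s] !=set0)
  then inf [set s | T s /\ t < s] else t.

Definition rho T t : R :=
  if pselect ([set s | T s /\ s < t] !=set0)
  then sup [set s | T s /\ s < t] else t.

Definition mu T t : R := sigma T t - t.
Definition nu T t : R := t - rho T t.

Definition right_scattered T t : Prop := t < sigma T t.
Definition right_dense T t : Prop := sigma T t = t.
Definition left_scattered T t : Prop := rho T t < t.
Definition left_dense T t : Prop := rho T t = t.

Definition two_sided_scattered T t : Prop :=
  left_scattered T t /\ right_scattered T t.
Definition two_sided_dense T t : Prop := left_dense T t /\ right_dense T t.

(* Derivatives are relations: "the derivative of f at t exists and is d". *)
Definition is_delta T f t d : Prop :=
  forall e : R, 0 < e -> \forall s \near within T (nbhs t),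
    `|f (sigma T t) - f s - d * (sigma T t - s)| <= e * `|sigma T t - s|.

(* The Delta-derivative of f must exist at all the points where its own
   Delta-derivative at t reads it: near t in T, and at sigma(t). *)
Definition is_delta2 T f t d : Prop :=
  exists g : R -> R,
    [/\ \forall s \near within T (nbhs t), is_delta T f s (g s),
        is_delta T f (sigma T t) (g (sigma T t)) &
        is_delta T g t d].

Definition is_diamond T alpha f t d : Prop :=
  forall e : R, 0 < e -> \forall s \near within T (nbhs t),
    let mu_ts := sigma T t - s in
    let eta_ts := rho T t - s in
    `|alpha * (f (sigma T t) - f s) * eta_ts
      + (1 - alpha) * (f (rho T t) - f s) * mu_ts
      - d * mu_ts * eta_ts| <= e * `|mu_ts * eta_ts|.

Definition continuous_at_in T f t : Prop := f @ within T (nbhs t) --> f t.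

Definition left_limit_in T f t : Prop :=
  exists l : R, f @ within [set s | T s /\ s < t] (nbhs t) --> l.

Definition right_limit_in T f t : Prop :=
  exists l : R, f @ within [set s | T s /\ t < s] (nbhs t) --> l.

Definition rd_continuous T f : Prop :=
  (forall t, T t -> right_dense T t -> continuous_at_in T f t) /\
  (forall t, T t -> left_dense T t -> left_limit_in T f t).

Definition ld_continuous T f : Prop :=
  (forall t, T t -> left_dense T t -> continuous_at_in T f t) /\
  (forall t, T t -> right_dense T t -> right_limit_in T f t).

Definition regressive T p : Prop :=
  rd_continuous T p /\ (forall t, T t -> 1 + mu T t * p t != 0).

Definition nu_regressive T p : Prop :=
  ld_continuous T p /\ (forall t, T t -> 1 - nu T t * p t != 0).

Definition regular_ts T : Prop :=
  time_scale T /\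
  (forall t, T t -> sigma T (rho T t) = t /\ rho T (sigma T t) = t).

(* The pieces T_1, ..., T_n are listed from left to right, so T_i is
   nth set0 Ts i.-1. *)
Record ordered_partition T (Ts : seq (set R)) : Prop := OrderedPartition {
  op_cover : T = \bigcup_(i in `I_(size Ts)) nth set0 Ts i ;
  op_nontrivial : forall i, (i < size Ts)%N ->
    forall t, nth set0 Ts i <> [set t] ;
  op_disjoint : forall i, (i.+1 < size Ts)%N ->
    tstar (nth set0 Ts i) `&` tstar (nth set0 Ts i.+1) = set0 ;
  op_consecutive : forall i, (i.+1 < size Ts)%N ->
    exists s, is_maximum (nth set0 Ts i) s /\ is_minimum (nth set0 Ts i.+1) s ;
  op_first : forall m, is_minimum (nth set0 Ts 0%N) m <-> is_minimum T m ;
  op_last : forall m,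
    is_maximum (nth set0 Ts (size Ts).-1) m <-> is_maximum T m ;
  op_regular : forall i, (i < size Ts)%N -> regular_ts (nth set0 Ts i) ;
  op_homogeneous : forall i, (i < size Ts)%N ->
    forall t, tstar (nth set0 Ts i) t ->
    two_sided_scattered T t \/ two_sided_dense T t ;
  op_junction : forall i, (i.+1 < size Ts)%N ->
    forall s, is_maximum (nth set0 Ts i) s -> is_minimum (nth set0 Ts i.+1) s ->
    forall e : R, 0 < e ->
    let L := [set t | s - e < t < s] `&` tstar (nth set0 Ts i) in
    let U := [set t | s < t < s + e] `&` nth set0 Ts i.+1 in
    [/\ L !=set0, U !=set0 &
        L `<=` two_sided_scattered T \/ U `<=` two_sided_scattered T]
}.

Definition atomic_ts T : Prop :=
  regular_ts T /\
  (forall Ts : seq (set R), ordered_partition T Ts <-> Ts = [:: T]).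

Definition equationI T alpha p y t : Prop :=
  exists d, is_diamond T alpha y t d /\ d - p t * y t = 0.

(* Where mu(s) = 0 the term alpha mu(s) y^{Delta Delta}(s) is zero and
   y^{Delta Delta}(s) is not required to exist: for T the real line and
   alpha = 1, say, the equation is y' - p y = 0 with p merely continuous, whose
   solutions need not be twice differentiable. *)
Definition equationII T alpha p y s : Prop :=
  exists d1 d2,
    [/\ is_delta T y s d1,
        mu T s != 0 -> is_delta2 T y s d2 &
        alpha * mu T s * d2 + (1 - p (sigma T s) * mu T s) * d1
          - p (sigma T s) * y s = 0].

Record solutionI T alpha p (t0 y0 : R) y : Prop := SolutionI {
  solI_rd : rd_continuous T y ;
  solI_ld : ld_continuous T y ;
  solI_eq : forall t, tstar T t -> equationI T alpha p y t ;
  solI_bc0 : y t0 = y0 ;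
  solI_bc1 : alpha * (1 - alpha) * y (rho T t0) = alpha * (1 - alpha) * y0
}.

Record solutionII T alpha p (s0 y0 : R) y : Prop := SolutionII {
  solII_rd : rd_continuous T y ;
  solII_ld : ld_continuous T y ;
  solII_eq : forall s, tstar T s -> equationII T alpha p y s ;
  solII_bc0 : y (sigma T s0) = y0 ;
  solII_bc1 : alpha * (1 - alpha) * y s0 = alpha * (1 - alpha) * y0
}.

End TimeScale.

(* Main.v *)
Require Import Defs.
From HB Require Import structures.
From mathcomp Require Import all_boot all_order all_algebra.
From mathcomp Require Import all_classical all_reals all_analysis.
From mathcomp Require Import ring.
Import Order.TTheory GRing.Theory Num.Theory.
Import numFieldNormedType.Exports.
Local Open Scope classical_set_scope.
Local Open Scope ring_scope.

(** Atomicity makes the trivial partition [T] an ordered partition of T, and the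
    homogeneity required of its single piece says that every point of T^* is
    two-sided scattered or two-sided dense.  Regularity makes rho and sigma inverse
    bijections of T^*, so the statement reduces to comparing equation (I) at t
    with equation (II) at s = rho(t), for one y at a time; the boundary
    conditions then agree because t0 = sigma(s0).

    If t is two-sided dense, then s = t and mu(s) = 0: the term with
    y^{Delta Delta} vanishes, and the diamond derivative is the
    Delta-derivative, because its defining estimate is that of the
    Delta-derivative multiplied by |t - u|.  Both equations read y'(t) = p(t) y(t).

    If t is two-sided scattered, then so is s, and both points are isolated
    in T.  A derivative at an isolated point is tested by the point
    itself alone, so it always exists and is a difference quotient.
    Writing q(u) = (y(sigma(u)) - y(u)) / mu(u), equation (I) at t is
      alpha q(t) + (1 - alpha) q(s) = p(t) y(t),
    the nabla quotient at t being q(s).  In (II) the term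
    alpha mu(s) y^{Delta Delta}(s) is alpha (q(t) - q(s)), and
    y(s) + mu(s) q(s) = y(t), so (II) at s is the same relation. *)

(** * Jump operators *)

Lemma closure_inf (R : realType) (A : set R) :
  A !=set0 -> has_lbound A -> closure A (inf A).
Proof.
move=> A0 lA U /nbhs_ballP[e /= e0 eU].
have [x Ax xe] := inf_adherent e0 (conj A0 lA).
exists x; split=> //; apply: eU.
rewrite /ball /= distrC ger0_norm ?subr_ge0 ?ge_inf//.
by rewrite ltrBlDl.
Qed.

Section Jumps.
Context {R : realType}.
Implicit Types (T : set R) (t u : R).

Lemma rho_le T t : rho T t <= t.
Proof.
rewrite /rho; case: pselect => // A0.
by apply: ge_sup => // u [_ /ltW].
Qed.

Lemma sigma_ge T t : t <= sigma T t.
Proof.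
rewrite /sigma; case: pselect => // A0.
by apply: lb_le_inf => // u [_ /ltW].
Qed.

Lemma le_rho {T t u} : T u -> u < t -> u <= rho T t.
Proof.
move=> Tu ut; rewrite /rho; case: pselect => [A0|[]]; last by exists u.
by apply: ub_le_sup => //; exists t => v [_ /ltW].
Qed.

Lemma sigma_le {T t u} : T u -> t < u -> sigma T t <= u.
Proof.
move=> Tu tu; rewrite /sigma; case: pselect => [A0|[]]; last by exists u.
by apply: ge_inf => //; exists t => v [_ /ltW].
Qed.

Lemma time_scale_rho {T t} : time_scale T -> T t -> T (rho T t).
Proof.
move=> [_ cT] Tt; rewrite /rho; case: pselect => // A0.
have cTT : closure T `<=` T by move/closure_id: cT => <-.
apply/cTT/(@closureS _ [set s | T s /\ s < t]).
  by move=> u [].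
by apply: closure_sup => //; exists t => u [_ /ltW].
Qed.

Lemma time_scale_sigma {T t} : time_scale T -> T t -> T (sigma T t).
Proof.
move=> [_ cT] Tt; rewrite /sigma; case: pselect => // A0.
have cTT : closure T `<=` T by move/closure_id: cT => <-.
apply/cTT/(@closureS _ [set s | T s /\ t < s]).
  by move=> u [].
by apply: closure_inf => //; exists t => u [_ /ltW].
Qed.

(** If rho(t) were the minimum m of T, then t = sigma(m); but regularity and
    rho(m) = m force sigma(m) = m. *)
Lemma tstar_rho T t : regular_ts T -> tstar T t -> tstar T (rho T t).
Proof.
move=> [tsT reg] [Tt [tmin tmax]]; split; first exact: time_scale_rho.
split=> -[Tr ext].
  have rr : rho T (rho T t) = rho T t.
    by apply/eqP; rewrite eq_le rho_le ext//; exact: time_scale_rho.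
  have rt : rho T t = t by rewrite -(reg _ Tr).1 rr (reg _ Tt).1.
  by apply: tmin; rewrite -rt.
by apply: tmax; split=> // u /ext ur; apply: le_trans ur (rho_le _ _).
Qed.

Lemma tstar_sigma T t : regular_ts T -> tstar T t -> tstar T (sigma T t).
Proof.
move=> [tsT reg] [Tt [tmin tmax]]; split; first exact: time_scale_sigma.
split=> -[Tr ext].
  by apply: tmin; split=> // u /ext; apply: le_trans (sigma_ge _ _).
have rr : sigma T (sigma T t) = sigma T t.
  by apply/eqP; rewrite eq_le sigma_ge ext//; exact: time_scale_sigma.
have rt : sigma T t = t by rewrite -(reg _ Tr).2 rr (reg _ Tt).2.
by apply: tmax; rewrite -rt.
Qed.

Lemma rho_bij T : regular_ts T -> set_bij (tstar T) (tstar T) (rho T).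
Proof.
move=> rT; have [_ reg] := rT; split=> [t|t u|t] /=.
- exact: tstar_rho.
- rewrite !inE => -[/reg[rt _] _] [/reg[ru _] _] tu.
  by rewrite -rt tu ru.
- move=> Tt; exists (sigma T t); first exact: tstar_sigma.
  by case: Tt => /reg[].
Qed.

Lemma eq_rho_sigma T s t : regular_ts T -> T s -> T t ->
  s = rho T t <-> t = sigma T s.
Proof.
move=> [_ reg] Ts Tt; split=> ->; first by rewrite (reg _ Tt).1.
by rewrite (reg _ Ts).2.
Qed.

Lemma atomic_homogeneous T t : atomic_ts T -> tstar T t ->
  two_sided_scattered T t \/ two_sided_dense T t.
Proof.
move=> [_ uniqT]; have trivT := (uniqT [:: T]).2 erefl.
exact: (op_homogeneous trivT (i := 0%N)).
Qed.

End Jumps.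

(** * Derivatives at scattered and at dense points *)

Section Derivatives.
Context {R : realType}.
Implicit Types (T : set R) (f : R -> R) (t d alpha : R).

Definition delta_quotient T f t : R := (f (sigma T t) - f t) / mu T t.

Lemma norm_le_all_multiples (x m : R) :
  (forall e, 0 < e -> `|x| <= e * `|m|) <-> x = 0.
Proof.
split=> [xm|-> e e0]; last by rewrite normr0 mulr_ge0// ltW.
apply/eqP; rewrite -normr_le0; apply/ler_addgt0Pl => e e0; rewrite addr0.
have m1 : 0 < `|m| + 1 by rewrite ltr_wpDl.
apply: le_trans (xm (e / (`|m| + 1)) (divr_gt0 e0 m1)) _.
by rewrite -mulrA ger_pMr// mulrC ler_pdivrMr// mul1r lerDl.
Qed.

(** The interval from rho(t) to sigma(t) is a neighbourhood of t that meets T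
    in t only. *)
Lemma near_scattered T t (P : R -> Prop) : T t -> two_sided_scattered T t ->
  (\forall u \near within T (nbhs t), P u) = P t.
Proof.
move=> Tt [lt rt]; rewrite near_withinE propeqE; split=> [|Pt].
  by move/nbhs_singleton; apply.
near=> u => Tu; have [ut|tu|->//] := ltgtP u t.
- suff : u <= rho T t by rewrite leNgt => /negP[]; near: u; exact: lt_nbhsr.
  exact: le_rho.
- suff : sigma T t <= u by rewrite leNgt => /negP[]; near: u; exact: lt_nbhsl.
  exact: sigma_le.
Unshelve. all: by end_near. Qed.

Lemma mu_scattered T t : two_sided_scattered T t -> mu T t != 0.
Proof. by move=> [_ rt]; rewrite /mu subr_eq0 gt_eqF. Qed.

Lemma is_delta_scattered T f t d : T t -> two_sided_scattered T t ->
  is_delta T f t d <-> d = delta_quotient T f t.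
Proof.
move=> Tt St; have m0 := mu_scattered _ _ St.
rewrite /is_delta; under eq_forall do rewrite (near_scattered _ _ _ Tt St).
rewrite norm_le_all_multiples /delta_quotient; split=> [/eqP|->].
  by rewrite subr_eq0 => /eqP ->; rewrite mulfK.
by rewrite divfK ?subrr.
Qed.

(** The second derivative at t reads f^Delta at t and at sigma(t) alone, and
    both values are difference quotients. *)
Lemma is_delta2_scattered T f t d : T t -> two_sided_scattered T t ->
  T (sigma T t) -> two_sided_scattered T (sigma T t) ->
  is_delta2 T f t d <->
  d = (delta_quotient T f (sigma T t) - delta_quotient T f t) / mu T t.
Proof.
move=> Tt St Tst Sst; split=> [[g []]|->].
  rewrite near_scattered// !is_delta_scattered// => gt gst ->.
  by rewrite {1}/delta_quotient gt gst.
exists (delta_quotient T f).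
by split; rewrite ?near_scattered// is_delta_scattered.
Qed.

Lemma is_diamond_scattered T alpha f t d : T t -> two_sided_scattered T t ->
  is_diamond T alpha f t d <->
  d = alpha * delta_quotient T f t + (1 - alpha) * ((f t - f (rho T t)) / nu T t).
Proof.
move=> Tt St; have m0 := mu_scattered _ _ St.
have n0 : nu T t != 0 by case: St => lt _; rewrite /nu subr_eq0 gt_eqF.
have n1 : rho T t - t = - nu T t by rewrite /nu opprB.
rewrite /is_diamond; under eq_forall do rewrite (near_scattered _ _ _ Tt St)/=.
rewrite norm_le_all_multiples n1 -/(mu T t) /delta_quotient.
set D := (X in _ <-> _ = X); split=> [E|->].
  apply/eqP; rewrite -subr_eq0; apply/eqP.
  apply: (mulIf m0); apply: (mulIf n0); rewrite !mul0r -[RHS]E /D.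
  by field; rewrite m0 n0.
by rewrite /D; field; rewrite m0 n0.
Qed.

(** Here both jumps fix t, so the estimate for the diamond derivative is the
    one for the Delta-derivative multiplied by |t - u|; at u = t, where this
    factor cannot be cancelled, both hold trivially. *)
Lemma is_diamond_dense T alpha f t d : two_sided_dense T t ->
  is_diamond T alpha f t d <-> is_delta T f t d.
Proof.
move=> [ld rd]; rewrite /is_diamond /is_delta ld rd /=.
have E u : alpha * (f t - f u) * (t - u) + (1 - alpha) * (f t - f u) * (t - u)
    - d * (t - u) * (t - u) = (f t - f u - d * (t - u)) * (t - u) by ring.
split=> H e /H; apply: filterS => u; rewrite E !normrM mulrA.
  have [->|ut] := eqVneq u t; first by rewrite !subrr mulr0 subr0 !normr0 !mulr0.
  by rewrite ler_pM2r// normr_gt0 subr_eq0 eq_sym.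
exact: ler_wpM2r.
Qed.

End Derivatives.

(** * Equivalence of the two equations *)

Lemma equation_dense (R : realType) (T : set R) alpha p y t :
  two_sided_dense T t -> equationI T alpha p y t <-> equationII T alpha p y t.
Proof.
move=> Dt; have [_ rd] := Dt.
have m0 : mu T t = 0 by rewrite /mu rd subrr.
rewrite /equationI /equationII m0 rd; split=> [[d [H E]]|[d [d2 [H _ E]]]].
  exists d, 0; split; [by apply/(is_diamond_dense T alpha)|by rewrite eqxx|].
  by rewrite -[RHS]E; ring.
exists d; split; first by apply/(is_diamond_dense T alpha).
by rewrite -[RHS]E; ring.
Qed.

(** With q the difference quotient, both equations become
    alpha q(t) + (1 - alpha) q(rho(t)) = p(t) y(t). *)
Lemma equation_scattered (R : realType) (T : set R) alpha p y t :
  T t -> two_sided_scattered T t -> T (rho T t) ->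
  two_sided_scattered T (rho T t) -> sigma T (rho T t) = t ->
  equationI T alpha p y t <-> equationII T alpha p y (rho T t).
Proof.
set s := rho T t => Tt St Ts Ss st.
have m0 : mu T s != 0 by exact: mu_scattered.
have nm : nu T t = mu T s by rewrite /nu /mu st.
have qs : (y t - y s) / nu T t = delta_quotient T y s.
  by rewrite nm /delta_quotient st.
have yt : y t = y s + mu T s * delta_quotient T y s.
  by rewrite -qs nm mulrC divfK// addrC subrK.
have d2P d2 : is_delta2 T y s d2 <->
    d2 = (delta_quotient T y t - delta_quotient T y s) / mu T s.
  by rewrite is_delta2_scattered ?st.
rewrite /equationI /equationII st; split.
  move=> [d []]; rewrite is_diamond_scattered// qs => -> E.
  exists (delta_quotient T y s).
  exists ((delta_quotient T y t - delta_quotient T y s) / mu T s).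
  split; [by rewrite is_delta_scattered|by move=> _; apply/d2P|].
  rewrite -[RHS]E [in RHS]yt; by field.
move=> [d1 [d2 [/is_delta_scattered -> // /(_ m0) /d2P -> E]]].
eexists; split; first by rewrite is_diamond_scattered.
by rewrite qs -[RHS]E [in LHS]yt; field.
Qed.

Lemma equationI_equationII (R : realType) (T : set R) alpha p y t :
  atomic_ts T -> tstar T t ->
  equationI T alpha p y t <-> equationII T alpha p y (rho T t).
Proof.
move=> hT Tt; have [rT _] := hT; have [tsT reg] := rT; have [T't _] := Tt.
have [|Dt] := atomic_homogeneous T t hT Tt; last first.
  by rewrite [rho T t]Dt.1; exact: equation_dense.
move=> St; have Ts := tstar_rho T t rT Tt; have st := (reg _ T't).1.
apply: equation_scattered => //; first exact: Ts.1.
have [//|[_]] := atomic_homogeneous T _ hT Ts; rewrite /right_dense st => tr.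
by case: St => + _; rewrite /left_scattered -tr ltxx.
Qed.

Theorem theorem6p8 (R : realType) (T : set R) (hT : atomic_ts T)
    (t0 : R) (ht0 : tstar T t0) (y0 : R) (p : R -> R)
    (hp : regressive T p) (hpnu : nu_regressive T p)
    (alpha : R) (halpha : 0 <= alpha <= 1)
    (s0 : R) (hs0 : s0 = rho T t0) :
  [/\ set_bij (tstar T) (tstar T) (rho T),
      forall s t : R, tstar T s -> tstar T t -> (s = rho T t <-> t = sigma T s),
      forall y : R -> R, rd_continuous T y -> ld_continuous T y ->
        forall s t : R, tstar T s -> tstar T t -> s = rho T t ->
        (equationI T alpha p y t <-> equationII T alpha p y s) &
      forall y : R -> R,
        solutionI T alpha p t0 y0 y <-> solutionII T alpha p s0 y0 y].
Proof.
have [rT _] := hT; have [_ reg] := rT; have [Tt0 _] := ht0.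
have st0 : sigma T s0 = t0 by rewrite hs0 (reg _ Tt0).1.
split=> [|s t [Ts _] [Tt _]|y _ _ s t _ Tt ->|y]; first exact: rho_bij.
- exact: eq_rho_sigma.
- exact: equationI_equationII.
split=> -[rd ld eqn bc0 bc1]; split=> //.
- move=> s Ts; have Tt := tstar_sigma T s rT Ts.
  by rewrite -(reg _ Ts.1).2; apply/equationI_equationII => //; exact: eqn.
- by rewrite st0.
- by rewrite hs0.
- move=> t Tt; apply/equationI_equationII => //.
  by apply: eqn; exact: tstar_rho.
- by rewrite -st0.
- by rewrite -hs0.
Qed.
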